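(* Let $\mathcal{M}=(E,r)$ be a matroid and let $D\subseteq E$ be a $k$-fold circuit of $\mathcal{M}$. Let $\{B_1,B_2,\ldots,B_\ell\}$ be the set of all $(k-1)$-fold circuits of $\mathcal{M}$ contained in $D$, and put $A_i=D\setminus B_i$ for $1\leq i\leq \ell$. Then $\{A_1,\dots,A_\ell\}$ is a partition of $D$ and $\ell\geq k$.
   Context: Matroids have finite ground sets. A cyclic set of a matroid $\mathcal{M}=(E,r)$ is a union of circuits, equivalently a set $D\subseteq E$ with $r(D-e)=r(D)$ for all $e\in D$. For a nonnegative integer $k$, a $k$-fold circuit of $\mathcal{M}$ is a cyclic set $D\subseteq E$ with $r(D)=|D|-k$. *)

(* Defs.v *)
From mathcomp Require Import all_boot all_order all_algebra.

Set Implicit Arguments.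
Unset Strict Implicit.
Unset Printing Implicit Defensive.

Record matroid (E : finType) := Matroid {
  rk : {set E} -> nat;
  rk_le_card : forall X : {set E}, rk X <= #|X|;
  rk_mono : forall X Y : {set E}, X \subset Y -> rk X <= rk Y;
  rk_submod : forall X Y : {set E}, rk (X :|: Y) + rk (X :&: Y) <= rk X + rk Y
}.

Section MatroidDefs.
Variables (E : finType) (M : matroid E).
Implicit Types (X C D : {set E}).

Definition independent X : bool := rk M X == #|X|.

Definition circuit C : bool := minset (fun X => ~~ independent X) C.

Definition cyclic_set D : bool :=
  [exists P : {set {set E}}, [forall C in P, circuit C] && (D == cover P)].

(* The index is an integer so that "(k-1)-fold" is meaningful for k = 0: since
   rk M D <= #|D|, there is no k-fold circuit with k < 0. *)
Definition fold_circuit (k : int) D : bool :=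
  cyclic_set D && ((rk M D)%:Z == #|D|%:Z - k)%R.

End MatroidDefs.

(* Main.v *)
Require Import Defs.
From mathcomp Require Import all_boot all_order all_algebra.
From mathcomp Require Import zify.

(** Write n(X) = |X| - r(X). Deleting an element e of D lowers n by one, and
    among the cyclic subsets of D - e there is exactly one, B_e, of nullity
    n(D) - 1; it contains all the others. Hence every e in D lies in exactly
    one of the sets D \ B. If T meets each D \ B, then a cyclic subset of D \ T
    lies in every B, hence is empty, so D \ T is independent and
    |D| - |T| <= r(D) = |D| - k; a transversal T has as many elements as there
    are sets B. *)

Section Nullity.
Set Implicit Arguments.
Unset Strict Implicit.
Variables (E : finType) (M : matroid E).
Implicit Types (C D X Y Z : {set E}) (e f : E).

Definition nullity X : nat := #|X| - rk M X.

Lemma nullityK X : rk M X + nullity X = #|X|.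
Proof. by rewrite subnKC // rk_le_card. Qed.

Lemma rk_le_setD1 X e : rk M X <= (rk M (X :\ e)).+1.
Proof.
have := rk_submod M (X :\ e) [set e]; have := rk_le_card M [set e].
have : rk M X <= rk M (X :\ e :|: [set e]).
  apply: rk_mono; apply/subsetP=> x xX.
  by rewrite !inE xX andbT; case: (x == e).
by rewrite cards1; lia.
Qed.

(** Submodularity for [X] and [Y :\: X] gives r(Y) <= r(X) + |Y - X|. *)
Lemma nullity_mono X Y : X \subset Y -> nullity X <= nullity Y.
Proof.
move=> sXY; have := rk_submod M X (Y :\: X).
have := rk_le_card M (Y :\: X); have := cardsID X Y.
have -> : X :|: Y :\: X = Y by rewrite -{1}(setIidPr sXY) setID.
rewrite (setIidPr sXY).
by have := nullityK X; have := nullityK Y; lia.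
Qed.

(** Submodularity for [X :\ e] and [Y], whose union is [X] and whose intersection is [Y :\ e]. *)
Lemma rk_setD1_mono Y X e :
  e \in Y -> Y \subset X -> rk M (Y :\ e) = rk M Y -> rk M (X :\ e) = rk M X.
Proof.
move=> eY sYX rkY; apply/eqP; rewrite eqn_leq rk_mono ?subD1set //=.
have := rk_submod M (X :\ e) Y.
have -> : X :\ e :|: Y = X.
  apply/setP=> x; rewrite !inE; case: (eqVneq x e) => [->|_] /=.
    by rewrite eY (subsetP sYX).
  by case xY: (x \in Y); rewrite ?orbT ?orbF // (subsetP sYX).
have -> : (X :\ e) :&: Y = Y :\ e by rewrite setIC setIDA (setIidPl sYX).
by rewrite rkY; lia.
Qed.

Lemma circuit_rk_setD1 C e : circuit M C -> e \in C -> rk M (C :\ e) = rk M C.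
Proof.
move=> /minsetP[depC minC] eC.
have indCe : independent M (C :\ e).
  apply/idPn=> /minC/(_ (subD1set _ _)) eqC.
  by have := setD11 e C; rewrite eqC eC.
move: indCe depC; rewrite /independent => /eqP rkCe.
have := cardsD1 e C; rewrite eC.
have := rk_mono M (subD1set C e); have := rk_le_card M C.
by lia.
Qed.

(* A minimal X inside D with e in X and r(X - e) = r(X) is a circuit. *)
Lemma circuit_of_rk_setD1 D e : e \in D -> rk M (D :\ e) = rk M D ->
  exists C, [/\ circuit M C, e \in C & C \subset D].
Proof.
move=> eD rkD; pose p X := (e \in X) && (rk M (X :\ e) == rk M X).
have [|X /minsetP[/andP[eX /eqP rkX] minX] sXD] := @minset_exists _ p D.
  by rewrite /p eD rkD eqxx.
exists X; split=> //.
(* If deleting [e] kept the rank of [X :\ f], this smaller set would satisfy [p]. *)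
have rkXf f : f \in X -> f != e -> rk M (X :\ f) = (rk M (X :\ f :\ e)).+1.
  move=> fX fe; have := rk_le_setD1 (X :\ f) e.
  have := rk_mono M (subD1set (X :\ f) e).
  have : rk M (X :\ f :\ e) <> rk M (X :\ f); last by lia.
  move=> eqrk; suff eqX : X :\ f = X by have := setD11 f X; rewrite eqX fX.
  by apply: minX (subD1set _ _); rewrite /p !inE eq_sym fe eX eqrk eqxx.
(* Deleting an element [f] of a circuit inside [X :\ e] keeps the ranks of both [X] and [X :\ e].
   These are equal, against [rkXf]. *)
have indXe : independent M (X :\ e).
  apply/idPn=> /(@minset_exists _ (fun X => ~~ independent M X))[C circC sC].
  have [C0|[f fC]] := set_0Vmem C.
    move/minsetP: circC => [/negP[]]; rewrite C0 /independent cards0.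
    by rewrite -leqn0 -(cards0 E) rk_le_card.
  have /setD1P[fe fX] := subsetP sC f fC.
  have rkC := circuit_rk_setD1 circC fC.
  have := rkXf f fX fe.
  rewrite (rk_setD1_mono fC (subset_trans sC (subD1set _ _)) rkC).
  have -> : X :\ f :\ e = X :\ e :\ f by rewrite !setDDl setUC.
  by rewrite (rk_setD1_mono fC sC rkC) rkX; lia.
move: indXe; rewrite /independent => /eqP cXe.
apply/minsetP; split=> [|Y depY sYX].
  by rewrite /independent; have := cardsD1 e X; rewrite eX; lia.
apply/eqP; rewrite eqEsubset sYX; apply/subsetP=> f fX; apply/idPn=> fY.
have sYXf : Y \subset X :\ f by rewrite subsetD1 sYX.
(* For [f] other than [e], the independent set [X :\ f :\ e] gains rank when [e] is added, by
   [rkXf]. *)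
have nullXf : nullity (X :\ f) = 0.
  rewrite /nullity; have [->|fe] := eqVneq f e; first by rewrite cXe subnn.
  have := rkXf f fX fe; have := nullity_mono (subD1set (X :\ e) f).
  rewrite /nullity cXe subnn.
  have -> : X :\ e :\ f = X :\ f :\ e by rewrite !setDDl setUC.
  have := cardsD1 e (X :\ f); rewrite !inE eq_sym fe eX /=.
  by lia.
move: depY; rewrite /independent; have := nullity_mono sYXf.
by have := nullityK Y; rewrite nullXf; lia.
Qed.

(** Replaces unions of circuits by a rank condition: [rk_setD1_mono] lifts it from a circuit to [D];
    conversely [D] is the union of all circuits inside it. *)
Lemma cyclic_setP D :
  reflect {in D, forall e, rk M (D :\ e) = rk M D} (cyclic_set M D).
Proof.
apply: (iffP existsP) => [[P /andP[/forall_inP circP /eqP ->]] e|cycD].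
  case/bigcupP=> C CP eC.
  have sC : C \subset cover P by apply: bigcup_sup CP.
  exact: rk_setD1_mono eC sC (circuit_rk_setD1 (circP C CP) eC).
exists [set C | circuit M C & C \subset D]; apply/andP; split.
  by apply/forall_inP=> C; rewrite inE => /andP[].
apply/eqP/setP=> e; apply/idP/bigcupP=> [eD|[C]].
  have [C [circC eC sCD]] := circuit_of_rk_setD1 eD (cycD e eD).
  by exists C; rewrite // inE circC.
by rewrite inE => /andP[_ /subsetP]; apply.
Qed.

Lemma cyclic_nullity_setD1 D e :
  cyclic_set M D -> e \in D -> (nullity (D :\ e)).+1 = nullity D.
Proof.
move=> /cyclic_setP cycD eD; have := cycD e eD; have := cardsD1 e D.
by rewrite eD; have := nullityK D; have := nullityK (D :\ e); lia.
Qed.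

(** Take [Y] minimal among the subsets of [X] with its nullity: deleting any element lowers the
    nullity, so it keeps the rank. *)
Lemma cyclic_core X :
  exists Y, [/\ Y \subset X, cyclic_set M Y & nullity Y = nullity X].
Proof.
have [|Y /minsetP[/eqP nY minY] sYX] :=
  @minset_exists _ (fun Y => nullity Y == nullity X) X; first exact: eqxx.
exists Y; split=> //; apply/cyclic_setP=> e eY.
have : nullity (Y :\ e) <> nullity X.
  move=> /eqP/minY/(_ (subD1set _ _)) eqY.
  by have := setD11 e Y; rewrite eqY eY.
have := nullity_mono (subD1set Y e); have := cardsD1 e Y; rewrite eY.
have := rk_mono M (subD1set Y e).
by have := nullityK Y; have := nullityK (Y :\ e); lia.
Qed.

(** Deleting an [e] in [Z] but not in [Y] would lower the nullity of [X], yet [X :\ e] still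
    contains [Y]. *)
Lemma cyclic_sub_core X Y Z :
    cyclic_set M Z -> Z \subset X -> Y \subset X -> nullity Y = nullity X ->
  Z \subset Y.
Proof.
move=> /cyclic_setP cycZ sZX sYX nY; apply/subsetP=> e eZ; apply/idPn=> eY.
have : Y \subset X :\ e by rewrite subsetD1 sYX.
move/nullity_mono; have := rk_setD1_mono eZ sZX (cycZ e eZ).
have := cardsD1 e X; rewrite (subsetP sZX) //.
by have := nullityK X; have := nullityK (X :\ e); lia.
Qed.

Lemma fold_circuitE (k : nat) D :
  fold_circuit M k%:Z%R D = cyclic_set M D && (nullity D == k).
Proof. by rewrite /fold_circuit; have := nullityK D; case: cyclic_set; lia. Qed.

(** The successor on the left makes this false at [k = 0], where a truncated [k - 1] would admit
    nullity 0. *)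
Lemma fold_circuit_predE (k : nat) D :
  fold_circuit M (k%:Z - 1)%R D = cyclic_set M D && ((nullity D).+1 == k).
Proof. by rewrite /fold_circuit; have := nullityK D; case: cyclic_set; lia. Qed.

End Nullity.

Theorem mainTheorem1 (E : finType) (M : matroid E) (k : nat) (D : {set E})
  (hD : fold_circuit M k%:Z%R D) :
  let Bs := [set B : {set E} | (B \subset D) && fold_circuit M (k%:Z - 1)%R B] in
  partition [set D :\: B | B in Bs] D /\ k <= #|Bs|.
Proof.
move=> Bs; move: hD; rewrite fold_circuitE => /andP[cycD /eqP nD].
have BsP B : B \in Bs ->
    [/\ B \subset D, cyclic_set M B & (nullity M B).+1 = k].
  by rewrite inE fold_circuit_predE => /and3P[? ? /eqP].
have nDe e : e \in D -> (nullity M (D :\ e)).+1 = k.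
  by move=> eD; rewrite cyclic_nullity_setD1.
(* [B] has the nullity of [D :\ e], so it contains every cyclic subset of [D :\ e]. *)
have subB B Z e : B \in Bs -> e \in D :\: B -> cyclic_set M Z ->
    Z \subset D -> e \notin Z -> Z \subset B.
  move=> /BsP[sBD _ nB] /setDP[eD eB] cycZ sZD eZ.
  apply: (@cyclic_sub_core _ M (D :\ e)); rewrite ?subsetD1 ?sZD ?sBD //.
  by have := nDe e eD; lia.
have eqB B B' e : B \in Bs -> B' \in Bs ->
    e \in D :\: B -> e \in D :\: B' -> B = B'.
  move=> BBs B'Bs eB eB'; apply/eqP; rewrite eqEsubset.
  have [sBD cycB _] := BsP B BBs; have [sB'D cycB' _] := BsP B' B'Bs.
  have /setDP[_ enB] := eB; have /setDP[_ enB'] := eB'.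
  by rewrite (subB B' B e) // (subB B B' e).
have neA B : B \in Bs -> exists e, e \in D :\: B.
  move=> /BsP[sBD _ nB]; have [A0|[e ?]] := set_0Vmem (D :\: B); last by exists e.
  have sDB : D \subset B by rewrite -setD_eq0 A0.
  by have := nullity_mono M sDB; lia.
have partD : partition [set D :\: B | B in Bs] D.
  apply/and3P; split.
  (* The block containing [e] is the complement in [D] of a cyclic core of [D :\ e]. *)
  - apply/eqP/setP=> e; apply/bigcupP/idP=> [[_ /imsetP[B _ ->] /setDP[]] //|eD].
    have [B [sB cycB nB]] := cyclic_core M (D :\ e).
    have [sBD eB] : B \subset D /\ e \notin B.
      by move: sB; rewrite subsetD1 => /andP[].
    exists (D :\: B); last by rewrite inE eB.
    by apply: imset_f; rewrite inE sBD fold_circuit_predE cycB nB nDe /=.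
  - apply/trivIsetP=> _ _ /imsetP[B BBs ->] /imsetP[B' B'Bs ->] neq.
    apply/pred0P=> e /=; apply/negbTE/andP=> -[eB eB'].
    by move: neq; rewrite (eqB B B' e) ?eqxx.
  - apply/imsetP=> -[B /neA[e eB] A0].
    by move: eB; rewrite -A0 inE.
split=> //.
have := transversalP partD; set T := transversal _ _ => trT.
have cT : #|T| <= #|Bs| by rewrite (card_transversal trT) leq_imset_card.
have [Y [sY cycY nY]] := cyclic_core M (D :\: T).
(* An [e] in [Y] lies in some [D :\: B], which [T] meets in a point [f] outside [Y]; then [subB]
   puts [Y], hence [e], in [B]. *)
have Y0 : Y = set0.
  apply/setP=> e; rewrite inE; apply/negP=> eY.
  have /setDP[eD _] := subsetP sY e eY.
  have : e \in cover [set D :\: B | B in Bs] by rewrite (cover_partition partD).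
  case/bigcupP=> _ /imsetP[B BBs ->] /setDP[_ /negP]; apply.
  have AP : D :\: B \in [set D :\: B | B in Bs] by apply: imset_f.
  have /and3P[_ _ /forall_inP/(_ _ AP)/cards1P[f TA]] := trT.
  have /setIP[fT fA] : f \in T :&: (D :\: B) by rewrite TA set11.
  apply: (subsetP (subB B Y f BBs fA cycY _ _)) => //.
    exact: subset_trans sY (subsetDl _ _).
  by apply: contraL fT => /(subsetP sY)/setDP[].
(* Now [D :\: T] has nullity 0, so |D| - |T| <= r(D) = |D| - k. *)
have := nullityK M D; have := nullityK M (D :\: T).
have := rk_mono M (subsetDl D T); rewrite -nY Y0 /nullity cards0.
have := cardsID T D; have := subset_leq_card (subsetIr D T).
by move: nD; rewrite /nullity; lia.
Qed.
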